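(* If a graph $G$ of order $n$ has no isolated vertices, then $$\gamma_{\rm sp}(G)\le n-\gamma(G).$$
   Context: All graphs are finite, simple and undirected. For a vertex $v$ of a graph $G$, $N(v)$ denotes the set of vertices adjacent to $v$. For $D\subseteq V(G)$ write $\overline{D}=V(G)\setminus D$. A set $D$ is dominating if every vertex in $\overline{D}$ has a neighbour in $D$; the domination number $\gamma(G)$ is the minimum cardinality of a dominating set. A set $D\subseteq V(G)$ is a super dominating set of $G$ if for every $u\in\overline{D}$ there exists $v\in D$ such that $N(v)\cap\overline{D}=\{u\}$; the super domination number $\gamma_{\rm sp}(G)$ is the minimum cardinality of a super dominating set of $G$. *)

(* Defs.v *)
From mathcomp Require Import all_boot.

Set Implicit Arguments.
Unset Strict Implicit.
Unset Printing Implicit Defensive.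

(* A finite simple graph is given by a vertex type T : finType and an adjacency
   relation e : rel T; symmetry and irreflexivity of e are separate hypotheses
   of the results that need them. *)

Definition nbhd (T : finType) (e : rel T) (v : T) : {set T} :=
  [set u | e v u].

Definition isolated (T : finType) (e : rel T) (v : T) : bool :=
  nbhd e v == set0.

Definition dominating (T : finType) (e : rel T) (D : {set T}) : bool :=
  [forall u in ~: D, exists v in D, u \in nbhd e v].

Definition super_dominating (T : finType) (e : rel T) (D : {set T}) : bool :=
  [forall u in ~: D, exists v in D, nbhd e v :&: ~: D == [set u]].

(* The whole vertex set is the witness required by [arg min]: by the two facts
   below it always belongs to the family over which the minimum is taken. *)
Lemma dominatingT (T : finType) (e : rel T) : dominating e [set: T].
Proof. by apply/forall_inP => u; rewrite !inE. Qed.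

Lemma super_dominatingT (T : finType) (e : rel T) :
  super_dominating e [set: T].
Proof. by apply/forall_inP => u; rewrite !inE. Qed.

Definition gamma (T : finType) (e : rel T) : nat :=
  #|[arg min_(D < [set: T] | dominating e D) #|D|]|.

Definition gamma_sp (T : finType) (e : rel T) : nat :=
  #|[arg min_(D < [set: T] | super_dominating e D) #|D|]|.

(* Hence #|T| - gamma e is never truncated. *)
Lemma gamma_le_order (T : finType) (e : rel T) : gamma e <= #|T|.
Proof. exact: max_card. Qed.

(* Main.v *)
(* The complement of [D] is super dominating exactly when every vertex of [D]
   has a private neighbour outside [D].  By a theorem of Bollobas and Cockayne,
   a graph without isolated vertices has a minimum dominating set with this
   property: take one inducing the fewest isolated vertices.  If [u] in [D] had
   no private neighbour outside [D], minimality would make [u] isolated in the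
   subgraph induced by [D], and exchanging [u] for any neighbour [w] would give
   a minimum dominating set inducing fewer isolated vertices. *)

Require Import Defs.
From mathcomp Require Import all_boot.

Set Implicit Arguments.
Unset Strict Implicit.
Unset Printing Implicit Defensive.

Definition induced_isolated (T : finType) (e : rel T) (D : {set T}) : {set T} :=
  [set x in D | [forall y in D, ~~ e x y]].

Lemma dominatingP (T : finType) (e : rel T) (D : {set T}) :
  reflect (forall u, u \notin D -> exists2 v, v \in D & e v u)
          (dominating e D).
Proof.
apply: (iffP forall_inP) => domD u uD.
  have /exists_inP[v vD] : [exists v in D, u \in nbhd e v].
    by apply: domD; rewrite inE.
  by rewrite inE; exists v.
have [|v vD evu] := domD u; first by rewrite inE in uD.
by apply/exists_inP; exists v; rewrite ?inE.
Qed.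

Lemma gamma_le (T : finType) (e : rel T) (D : {set T}) :
  dominating e D -> gamma e <= #|D|.
Proof.
rewrite /gamma; case: arg_minnP => [|D0 _ minD0]; last exact: minD0.
exact: dominatingT.
Qed.

Lemma gamma_sp_le (T : finType) (e : rel T) (D : {set T}) :
  super_dominating e D -> gamma_sp e <= #|D|.
Proof.
rewrite /gamma_sp; case: arg_minnP => [|D0 _ minD0]; last exact: minD0.
exact: super_dominatingT.
Qed.

Lemma gamma_attained (T : finType) (e : rel T) :
  exists2 D : {set T}, dominating e D & #|D| = gamma e.
Proof.
rewrite /gamma; case: arg_minnP => [|D domD _]; first exact: dominatingT.
by exists D.
Qed.

(** Since [u] already lies in [nbhd e x :&: D], this set can differ from [[set u]] only by a second
    element. Thus [x] stays dominated when [u] leaves [D]. *)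
Lemma other_neighbour (T : finType) (e : rel T) (D : {set T}) (u x : T) :
  symmetric e -> u \in D -> e x u -> nbhd e x :&: D != [set u] ->
  exists2 y, y \in D :\ u & e y x.
Proof.
move=> e_sym uD exu notpriv; have : [exists y in D :\ u, e y x].
  apply: contraR notpriv => /exists_inPn noy; apply/eqP/setP=> y.
  rewrite !inE; case: (eqVneq y u) => [-> | yu]; first by rewrite exu uD.
  apply/negP=> /andP[exy yD].
  by have := noy y; rewrite !inE yu yD e_sym exy => /(_ isT).
by case/exists_inP=> y; exists y.
Qed.

(** A neighbour [y] of [u] in [D] would make [D :\ u] dominating, against minimality: [y] covers
    [u], and a vertex outside [D] never depends on [u] alone. *)
Lemma no_private_isolated (T : finType) (e : rel T) (D : {set T}) (u : T) :
  symmetric e -> irreflexive e -> dominating e D -> #|D| = gamma e ->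
  u \in D -> (forall v, v \notin D -> nbhd e v :&: D != [set u]) ->
  u \in induced_isolated e D.
Proof.
move=> e_sym e_irr domD minD uD nopriv; rewrite inE uD /=.
apply/forall_inP=> y yD; apply/negP=> euy.
have yu : y != u by apply: contraTneq euy => ->; rewrite e_irr.
suff /gamma_le : dominating e (D :\ u).
  by rewrite -minD (cardsD1 u D) uD ltnn.
apply/dominatingP=> x; rewrite !inE negb_and negbK.
case/orP=> [/eqP-> | xD]; first by exists y; rewrite ?inE ?yu // e_sym.
have /dominatingP/(_ x xD)[v vD evx] := domD.
have [vu | vu] := eqVneq v u; last by exists v; rewrite ?inE ?vu.
by apply: other_neighbour (nopriv x xD); rewrite // e_sym -vu.
Qed.

(** Only [u] and its neighbours outside [D] could suffer from the exchange: [w] covers [u], and the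
    others have a second neighbour in [D]. *)
Lemma exchange_dominating (T : finType) (e : rel T) (D : {set T}) (u w : T) :
  symmetric e -> dominating e D -> u \in D -> e u w ->
  (forall v, v \notin D -> nbhd e v :&: D != [set u]) ->
  dominating e (w |: D :\ u).
Proof.
move=> e_sym domD uD euw nopriv; apply/dominatingP=> x.
have [-> _ | xu] := eqVneq x u; first by exists w; rewrite ?setU11 // e_sym.
rewrite !inE xu negb_or /= => /andP[_ xD].
have /dominatingP/(_ x xD)[v vD evx] := domD.
have [vu | vu] := eqVneq v u; last by exists v; rewrite // !inE vu vD orbT.
have [|y yD eyx] := other_neighbour e_sym uD _ (nopriv x xD).
  by rewrite e_sym -vu.
by exists y => //; rewrite setU1r.
Qed.

Lemma exchange_induced_isolated (T : finType) (e : rel T) (D : {set T})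
    (u w y : T) :
  symmetric e -> u \in induced_isolated e D -> w \notin D ->
  y \in D :\ u -> e y w ->
  induced_isolated e (w |: D :\ u) \proper induced_isolated e D.
Proof.
move=> e_sym isou wD yDu eyw.
move: (isou); rewrite inE => /andP[uD /forall_inP isou'].
apply/properP; split; last first.
  (* Strictness: [u] is lost, as it lies outside the new set. *)
  by exists u; rewrite // !inE eqxx orbF; case: eqVneq wD => // <-; rewrite uD.
apply/subsetP=> x; rewrite inE => /andP[xD' /forall_inP isox].
(* The newcomer [w] is not isolated, since its neighbour [y] stays in the set. *)
have xw : x != w.
  by apply: contraNneq (isox y (setU1r w yDu)) => ->; rewrite e_sym.
move: xD'; rewrite !inE (negPf xw) /= => /andP[xu xD]; rewrite xD /=.
(* Removing [u] isolates no vertex anew, because [u] had no neighbour in [D]. *)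
apply/forall_inP=> z zD; have [-> | zu] := eqVneq z u.
  by rewrite e_sym isou'.
by apply: isox; rewrite !inE zu zD orbT.
Qed.

Theorem bollobas_cockayne (T : finType) (e : rel T) :
  symmetric e -> irreflexive e -> (forall v, ~~ isolated e v) ->
  exists D : {set T}, [/\ dominating e D, #|D| = gamma e &
    forall u, u \in D -> exists2 v, v \notin D & nbhd e v :&: D = [set u]].
Proof.
move=> e_sym e_irr noiso; have [D0 domD0 minD0] := gamma_attained e.
pose minimum D := dominating e D && (#|D| == gamma e).
have : minimum D0 by rewrite /minimum domD0 minD0 eqxx.
case/(@arg_minnP _ D0 minimum (fun D => #|induced_isolated e D|)).
move=> D /andP[domD /eqP minD] fewest; exists D; split=> // u uD.
have [/exists_inP[v vD /eqP] | /exists_inPn nopriv] :=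
  boolP [exists v in ~: D, nbhd e v :&: D == [set u]].
  by rewrite inE in vD; exists v.
have {}nopriv v : v \notin D -> nbhd e v :&: D != [set u].
  by move=> vD; apply: nopriv; rewrite inE.
have isou := no_private_isolated e_sym e_irr domD minD uD nopriv.
have /set0Pn[w] := noiso u; rewrite inE => euw.
have wD : w \notin D.
  apply/negP=> wD; move: isou; rewrite inE => /andP[_ /forall_inP/(_ w wD)].
  by rewrite euw.
(* As [w] is not private to [u], it has a neighbour [y] that survives the exchange. *)
have [|y yD eyw] := other_neighbour e_sym uD _ (nopriv w wD).
  by rewrite e_sym.
have /fewest : minimum (w |: D :\ u).
  rewrite /minimum (exchange_dominating e_sym domD uD euw nopriv) /=.
  by rewrite cardsU1 !inE (negPf wD) andbF -minD (cardsD1 u D) uD.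
by rewrite leqNgt proper_card // (exchange_induced_isolated e_sym isou wD yD).
Qed.

Theorem theorem12 (T : finType) (e : rel T) (n : nat)
    (e_sym : symmetric e) (e_irr : irreflexive e)
    (order_n : #|T| = n)
    (no_isolated : forall v : T, ~~ isolated e v) :
  gamma_sp e <= n - gamma e.
Proof.
have [D [_ <- priv]] := bollobas_cockayne e_sym e_irr no_isolated.
(* The bound becomes [#|~: D|], so [~: D] is the super dominating set to exhibit. *)
rewrite -order_n -(cardsC D) addKn; apply: gamma_sp_le.
apply/forall_inP=> u; rewrite setCK => /priv[v vD privv].
by apply/exists_inP; exists v; rewrite ?inE ?privv.
Qed.
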